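(* For any constant $p\in(0,1)$ and any (fixed) graph $F$ with at least one edge, with high probability, $$\mathrm{sat}\big(\mathbb{G}(n,p),F\big)\geqslant\frac{w(F)-1}{2}n-O(\log n).$$
   Context: All graphs are finite, undirected, without loops or multiple edges. For a graph $F$, $w(F)=\min_{xy\in E(F)}\big\{\max\{d(x),d(y)\}+|N(x)\cap N(y)|\big\}$, where $d(x)$ and $N(x)$ are the degree and the neighborhood of $x$ in $F$. For graphs $G$ and $F$, a graph is $F$-free if it has no subgraph (not necessarily induced) isomorphic to $F$. A spanning subgraph $H$ of $G$ is an $F$-saturated subgraph of $G$ if $H$ is $F$-free and adding any edge of $E(G)\setminus E(H)$ to $H$ creates a copy of $F$. $\mathrm{sat}(G,F)$ denotes the minimum number of edges in an $F$-saturated subgraph of $G$. $\mathbb{G}(n,p)$ is the Erdős–Rényi random graph on a fixed vertex set of size $n$, where every two distinct vertices are adjacent independently with probability $p$. ''With high probability'' means with probability tending to $1$ as $n\to\infty$. The implied constant in $O(\log n)$ depends only on $p$ and $F$. *)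

(* Defs.v *)
From HB Require Import structures.
From mathcomp Require Import all_boot all_order all_algebra.
From mathcomp Require Import all_classical all_reals all_analysis.

Set Implicit Arguments.
Unset Strict Implicit.
Unset Printing Implicit Defensive.

Import Order.TTheory GRing.Theory Num.Theory.
Import numFieldNormedType.Exports.

(* Loopless simple graphs: an edge is a set of exactly two vertices. *)
Record sgraph (V : finType) := SGraph {
  edges : {set {set V}};
  edges_card2 : [forall e in edges, #|e| == 2] }.

HB.instance Definition _ (V : finType) := [isSub for @edges V].
HB.instance Definition _ (V : finType) := [Finite of sgraph V by <:].

Section Graphs.
Variable V : finType.
Implicit Types (G H : sgraph V) (E : {set {set V}}) (e : {set V}) (x y : V).

Lemma sgraph_of_subproof E :
  [forall e in [set e in E | #|e| == 2], #|e| == 2].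
Proof. by apply/forall_inP => e; rewrite inE => /andP[]. Qed.

(* Members of [E] that are not pairs are discarded. *)
Definition sgraph_of E : sgraph V := SGraph (sgraph_of_subproof E).

Definition add_edge H e : sgraph V := sgraph_of (e |: edges H).

(* For x = y the set below is a singleton, hence not an edge. *)
Definition adj G x y : bool := [set x; y] \in edges G.

Definition nbhd G x : {set V} := [set y | adj G x y].

Definition deg G x : nat := #|nbhd G x|.

(* The index of the iterated minimum is only a default: it bounds all the
   terms, see [w_le] and [w_attained]. *)
Definition w G : nat :=
  \big[minn/#|V| + #|V|]_(xy : V * V | adj G xy.1 xy.2)
    (maxn (deg G xy.1) (deg G xy.2) + #|nbhd G xy.1 :&: nbhd G xy.2|).

End Graphs.

Section Saturation.
Variables U V : finType.
Implicit Types (F : sgraph U) (G H : sgraph V).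

Definition contains_copy H F : bool :=
  [exists f : {ffun U -> V}, injectiveb f &&
    [forall x, forall y, adj F x y ==> adj H (f x) (f y)]].

Definition free H F : bool := ~~ contains_copy H F.

Definition saturated_subgraph G F H : bool :=
  [&& edges H \subset edges G, free H F &
      [forall e in edges G :\: edges H, contains_copy (add_edge H e) F]].

(* The index of the iterated minimum is only a default: it bounds all the
   terms, see [sat_le] and [sat_attained]. *)
Definition sat G F : nat :=
  \big[minn/#|edges G|]_(H : sgraph V | saturated_subgraph G F H) #|edges H|.

End Saturation.

Section RandomGraph.
Local Open Scope ring_scope.
Variables (R : realType) (p : R) (n : nat).

(* Law of G(n,p) on the labelled graphs with vertex set 'I_n: the pairs of
   vertices are independently edges with probability p. *)
Definition gnp_mass (G : sgraph 'I_n) : R :=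
  \prod_(e : {set 'I_n} | #|e| == 2%N) (if e \in edges G then p else 1 - p).

Definition gnp_prob (A : pred (sgraph 'I_n)) : R :=
  \sum_(G : sgraph 'I_n | A G) gnp_mass G.

End RandomGraph.

Section Sanity.

Lemma edges_add_edge (V : finType) (H : sgraph V) (e : {set V}) :
  #|e| = 2 -> edges (add_edge H e) = e |: edges H.
Proof.
move=> e2; apply/setP => e'; rewrite !inE.
case: eqVneq => [->|_] /=; first by rewrite e2.
by case: (boolP (e' \in edges H)) => // /(forall_inP (edges_card2 H)) ->.
Qed.

Lemma bigminn_le (I : finType) (P : pred I) (f : I -> nat) d i :
  P i -> \big[minn/d]_(j | P j) f j <= f i.
Proof.
move=> Pi; have := mem_index_enum i; elim: (index_enum I) => //= j r IHr.
rewrite inE big_cons => /predU1P[<-|/IHr le_r]; first by rewrite Pi geq_minl.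
by case: ifP => // _; apply: leq_trans (geq_minr _ _) le_r.
Qed.

Lemma bigminn_attained (I : finType) (P : pred I) (f : I -> nat) d i :
  (forall j, P j -> f j <= d) -> P i ->
  exists2 j, P j & \big[minn/d]_(j | P j) f j = f j.
Proof.
move=> fd Pi; case: (@arg_minnP I i P f Pi) => j Pj minj.
exists j => //; apply/eqP; rewrite eqn_leq bigminn_le //=.
elim/big_ind: _ => [|a b ja jb|k /minj //]; first exact: fd.
by rewrite leq_min ja.
Qed.

Lemma w_le (V : finType) (G : sgraph V) x y : adj G x y ->
  w G <= maxn (deg G x) (deg G y) + #|nbhd G x :&: nbhd G y|.
Proof. by move=> xy; exact: (@bigminn_le _ _ _ _ (x, y)). Qed.

Lemma edges_adj (V : finType) (G : sgraph V) :
  edges G != finset.set0 -> exists x y, adj G x y.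
Proof.
case/set0Pn => e eG; have /cards2P[x [y [_ ee]]] := forall_inP (edges_card2 G) e eG.
by exists x, y; rewrite /adj -ee.
Qed.

Lemma w_attained (V : finType) (G : sgraph V) : edges G != finset.set0 ->
  exists x y, adj G x y /\
    w G = maxn (deg G x) (deg G y) + #|nbhd G x :&: nbhd G y|.
Proof.
move=> /edges_adj[x [y xy]].
have [|[a b] ab wE] := @bigminn_attained _ (fun e : V * V => adj G e.1 e.2)
  (fun e => maxn (deg G e.1) (deg G e.2) + #|nbhd G e.1 :&: nbhd G e.2|)
  (#|V| + #|V|) (x, y) _ xy; last by exists a, b.
by move=> e _; rewrite leq_add ?geq_max ?max_card.
Qed.

Lemma sat_le (U V : finType) (F : sgraph U) (G H : sgraph V) :
  saturated_subgraph G F H -> sat G F <= #|edges H|.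
Proof. exact: bigminn_le. Qed.

Lemma saturated_subgraph_exists (U V : finType) (F : sgraph U) (G : sgraph V) :
  edges F != finset.set0 -> exists H, saturated_subgraph G F H.
Proof.
move=> /edges_adj[x [y xy]].
pose P (H : sgraph V) := (edges H \subset edges G) && free H F.
have P0 : P (sgraph_of finset.set0).
  apply/andP; split; first by apply/fintype.subsetP => e; rewrite !inE.
  apply/negP => /existsP[f /andP[_ /forallP/(_ x)/forallP/(_ y)]].
  by rewrite xy /adj !inE.
case: (@arg_maxnP _ _ P (fun H => #|edges H|) P0) => H /andP[HG HF] maxH.
exists H; rewrite /saturated_subgraph HG HF /=.
apply/forall_inP => e; rewrite inE => /andP[eH eG].
apply: contraT => fre.
have e2 : #|e| = 2 by apply/eqP/(forall_inP (edges_card2 G)).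
have /maxH : P (add_edge H e).
  by rewrite /P edges_add_edge // finset.subUset finset.sub1set eG HG.
by rewrite edges_add_edge // cardsU1 eH add1n /= ltnn.
Qed.

Lemma sat_attained (U V : finType) (F : sgraph U) (G : sgraph V) :
  edges F != finset.set0 ->
  exists2 H, saturated_subgraph G F H & sat G F = #|edges H|.
Proof.
move=> /(saturated_subgraph_exists G)[H satH].
by apply: (bigminn_attained _ satH) => K /and3P[KG _ _]; exact: subset_leq_card.
Qed.

Lemma gnp_prob_total (R : realType) (p : R) (n : nat) :
  gnp_prob p (@predT (sgraph 'I_n)) = 1%R.
Proof.
pose a (e : {set 'I_n}) : R := (if #|e| == 2%N then p else 0)%R.
pose b (e : {set 'I_n}) : R := (if #|e| == 2%N then 1 - p else 1)%R.
have <- : (\prod_(e : {set 'I_n}) (a e + b e) = 1)%R.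
  by apply: big1 => e _; rewrite /a /b; case: ifP => _; rewrite ?add0r // addrC subrK.
rewrite bigA_distr /gnp_prob.
rewrite (bigID (fun J : {set {set 'I_n}} => [forall e in J, #|e| == 2])) /=.
rewrite [X in (_ + X)%R]big1 ?addr0 => [|J /forall_inPn[e eJ e2]]; last first.
  by rewrite (bigD1 e) //= eJ /a (negbTE e2) mul0r.
rewrite [RHS](reindex (@edges 'I_n)) /=; last first.
  exists (@sgraph_of 'I_n) => [G _|J /forall_inP J2].
    apply: val_inj; apply/setP => e /=; rewrite inE.
    by case: (boolP (e \in edges G)) => // /(forall_inP (edges_card2 G)) ->.
  apply/setP => e /=; rewrite inE.
  by case: (boolP (e \in J)) => // /J2 ->.
apply: eq_big => [G|G _]; first by rewrite edges_card2.
rewrite /gnp_mass big_mkcond /=; apply: eq_bigr => e _; rewrite /a /b.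
case: ifP => // e2; case: ifP => // eG.
by have := forall_inP (edges_card2 G) e eG; rewrite e2.
Qed.

End Sanity.

(* Main.v *)
(* Let [k = w F - 1], let [H] be saturated in [G], and let [I] collect maximal
   [G]-independent sets of each of the classes of vertices of [H]-degree [d < k],
   so that [#|I| <= k * alpha(G)]. The set [B] of [H]-neighbours of [I] has at
   most [k * #|I|] elements. A vertex [v] outside [I] and [B] of degree [d < k] is
   [G]-adjacent to some [u] in [I] of the same degree [d]; adding [uv] to [H]
   completes a copy of [F], so [u] and [v] have at least [k - d] common
   neighbours, all in [B]. Hence [deg v] plus the number of neighbours of [v] in
   [B] is at least [k], and summing over [v] gives
   [k n <= 2 e(H) + O(alpha(G))]. By the first moment method,
   [alpha(G(n,p)) = O(log n)] with high probability. *)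
Require Import Defs.
From mathcomp Require Import all_boot all_order all_algebra.
From mathcomp Require Import all_classical all_reals all_analysis.
From mathcomp Require Import zify ring lra.
Import Order.TTheory GRing.Theory Num.Theory.
Import numFieldNormedType.Exports.

(** * Degree sums and independent sets *)

Section Graphs.
Variables (V : finType).
Implicit Types (G H : sgraph V) (x y : V) (S : {set V}).

Lemma adj_sym G x y : adj G x y = adj G y x.
Proof. by rewrite /adj finset.setUC. Qed.

Lemma adj_neq G x y : adj G x y -> x != y.
Proof. by move=> /(forall_inP (edges_card2 G)); rewrite cards2; case: (x != y). Qed.

Lemma adj_add_edge H u v x y :
  adj (add_edge H [set u; v]) x y -> [set x; y] != [set u; v] -> adj H x y.
Proof. by rewrite /adj !inE => /andP[/orP[->|]]. Qed.

Lemma sum_deg_le H : \sum_x deg H x <= 2 * #|edges H|.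
Proof.
have -> : 2 * #|edges H| = \sum_(e in edges H) \sum_(x in e) 1.
  rewrite mulnC -sum_nat_const; apply: eq_bigr => e.
  by move=> /(forall_inP (edges_card2 H))/eqP; rewrite sum1_card.
rewrite (exchange_big_dep predT) //=; apply: leq_sum => x _.
rewrite sum1dep_card /deg.
have /card_in_imset <- : {in nbhd H x &, injective (fun y => [set x; y])}.
  move=> y z; rewrite !inE => /adj_neq xy _ /setP/(_ y).
  by rewrite !inE eqxx orbT eq_sym (negbTE xy) /= => /esym/eqP.
apply/subset_leq_card/fintype.subsetP => e /imsetP[y].
by rewrite !inE => xy ->; rewrite !inE eqxx andbT.
Qed.

Definition independent G S := [forall x in S, forall y in S, ~~ adj G x y].

Lemma independentP G S :
  reflect {in S &, forall x y, ~~ adj G x y} (independent G S).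
Proof.
apply: (iffP forall_inP) => [i x y xS yS|i x xS].
  by have /forall_inP := i x xS; apply.
by apply/forall_inP => y; apply: i.
Qed.

Lemma independent_sub G S S' : S \subset S' -> independent G S' -> independent G S.
Proof.
move=> /fintype.subsetP SS' /independentP i; apply/independentP => x y /SS' xS /SS'.
exact: i.
Qed.

(** A condition on each edge separately, the form in which the product weight [gnp_mass] can be
    summed. *)
Lemma independent_edges G S :
  independent G S = [forall e in edges G, ~~ (e \subset S)].
Proof.
apply/independentP/forall_inP => [i e eG|i x y xS yS].
  have /cards2P[x [y [_ ee]]] := forall_inP (edges_card2 G) e eG.
  apply: contraL eG; rewrite ee finset.subUset !finset.sub1set => /andP[xS yS].
  exact: i.
by apply: contraL (erefl true) => /i; rewrite finset.subUset !finset.sub1set xS yS.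
Qed.
End Graphs.

Arguments independent {V} G S.
Arguments independentP {V G S}.

(** * The deterministic lower bound for saturated subgraphs *)

Section Saturation.
Variables (U V : finType) (F : sgraph U) (G H : sgraph V).

(** As [H] is [F]-free, the copy of [F] created by adding uv maps some edge xy of [F] onto uv. Its
    other edges lie in [H], so passing from x and y to their images loses at most one from each
    degree, for uv itself, and no common neighbour. *)
Lemma saturated_nonedge u v : saturated_subgraph G F H ->
  adj G u v -> ~~ adj H u v ->
  w F <= (maxn (deg H u) (deg H v) + #|nbhd H u :&: nbhd H v|).+1.
Proof.
case/and3P => _ freeH /forall_inP satH uvG uvH.
have /satH/existsP[f /andP[/injectiveP f_inj /forallP fE]] :
    [set u; v] \in edges G :\: edges H by rewrite inE uvH.
have {}fE x y : adj F x y -> adj (add_edge H [set u; v]) (f x) (f y).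
  by have /forallP/(_ y)/implyP := fE x.
have /existsP[x /existsP[y /andP[xy /eqP exy]]] :
    [exists x, exists y, adj F x y && ([set f x; f y] == [set u; v])].
  apply: contraNT freeH => /existsPn nxy; apply/existsP; exists f.
  apply/andP; split; first exact/injectiveP.
  apply/forallP => x; apply/forallP => y; apply/implyP => xy.
  by apply: adj_add_edge (fE _ _ xy) _; have /existsPn/(_ y) := nxy x; rewrite xy.
have lift_adj x' y' z : [set f x'; f y'] = [set u; v] -> adj F x' z -> z != y' ->
    adj H (f x') (f z).
  move=> exy' xz zy; apply: adj_add_edge (fE _ _ xz) _; apply/eqP => e.
  have : f z \in [set f x'; f y'] by rewrite exy' -e !inE eqxx orbT.
  by rewrite !inE !(inj_eq f_inj) (negbTE zy) orbF eq_sym (negbTE (adj_neq _ _ _ _ xz)).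
have deg_f x' y' : [set f x'; f y'] = [set u; v] -> deg F x' <= (deg H (f x')).+1.
  move=> exy'; rewrite /deg (cardsD1 y') -add1n leq_add ?leq_b1 //.
  rewrite -(card_imset _ f_inj); apply/subset_leq_card/fintype.subsetP => _ /imsetP[z + ->].
  by rewrite !inE => /andP[zy xz]; exact: lift_adj exy' xz zy.
have eyx : [set f y; f x] = [set u; v] by rewrite finset.setUC.
have codeg_f : #|nbhd F x :&: nbhd F y| <= #|nbhd H (f x) :&: nbhd H (f y)|.
  rewrite -(card_imset _ f_inj); apply/subset_leq_card/fintype.subsetP => _ /imsetP[z + ->].
  rewrite !inE => /andP[xz yz].
  have [zx zy] : z != x /\ z != y by rewrite ![z == _]eq_sym !(adj_neq _ F).
  by rewrite (lift_adj x y z) ?(lift_adj y x z).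
have -> : maxn (deg H u) (deg H v) + #|nbhd H u :&: nbhd H v| =
    maxn (deg H (f x)) (deg H (f y)) + #|nbhd H (f x) :&: nbhd H (f y)|.
  have fxy : f x != f y by rewrite (inj_eq f_inj) (adj_neq _ _ _ _ xy).
  have : f x \in [set u; v] by rewrite -exy !inE eqxx.
  have : f y \in [set u; v] by rewrite -exy !inE eqxx orbT.
  rewrite !inE => /orP[]/eqP ey /orP[]/eqP ex; move: fxy; rewrite ex ey ?eqxx //.
  by rewrite maxnC finset.setIC.
apply: leq_trans (w_le xy) _; rewrite -addSn leq_add //.
by rewrite -maxnSS geq_max !leq_max (deg_f x y) // (deg_f y x) ?orbT.
Qed.

Lemma saturated_lower_bound (a : nat) : saturated_subgraph G F H ->
  (forall S, independent G S -> #|S| <= a) ->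
  (w F).-1 * #|V| <= 2 * #|edges H| + (w F) ^ 3 * a.
Proof.
move=> satH indep; set k := (w F).-1.
(* Independence is asked only within each degree class, so one inclusion-maximal set serves all
   classes at once. *)
pose P (I : {set V}) := [forall x in I, deg H x < k] &&
  [forall x in I, forall y in I, (deg H x == deg H y) ==> ~~ adj G x y].
have P0 : P finset.set0.
  by apply/andP; split; apply/forall_inP => x; rewrite inE.
have [I maxI _] := @maxset_exists _ P finset.set0 P0.
have /andP[/forall_inP Ilow /forall_inP Iind] := maxsetp maxI.
have {}Iind x y : x \in I -> y \in I -> deg H x = deg H y -> ~~ adj G x y.
  by move=> /Iind/forall_inP i /i/implyP + /eqP; apply.
pose B := \bigcup_(x in I) nbhd H x.
have cardI : #|I| <= k * a.
  (* [inord] needs a nonempty ordinal type, hence ['I_k.+1]. The top class, of degree [k], is empty;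
     each of the other [k] has at most [a] elements. *)
  rewrite -sum1_card (partition_big (fun x => inord (deg H x) : 'I_k.+1) predT) //=.
  rewrite big_ord_recr /= [X in _ + X]big1 ?addn0; last first.
    move=> x /andP[xI /eqP/(congr1 val)] /=.
    by have lx := Ilow x xI; rewrite inordK ?(leqW lx) // => e; rewrite e ltnn in lx.
  rewrite -[k in k * a]card_ord -sum_nat_const; apply: leq_sum => i _.
  rewrite sum1dep_card; apply: indep; apply/independentP => x y.
  rewrite !inE => /andP[xI /eqP/(congr1 val) /= ex] /andP[yI /eqP/(congr1 val) /= ey].
  by apply: Iind => //; move: ex ey; rewrite !inordK ?(leqW (Ilow _ _)) // => -> ->.
have cardB : #|B| <= #|I| * k.
  rewrite -sum_nat_const; apply: (@leq_trans (\sum_(x in I) deg H x)); last first.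
    by apply: leq_sum => x /Ilow/ltnW.
  rewrite /B; elim/big_rec2: _ => [|x n S _ le]; first by rewrite cards0.
  by apply: leq_trans (leq_card_setU _ _) _; rewrite leq_add2l.
pose eB v := #|nbhd H v :&: B|.
have good v : v \notin I :|: B -> k <= deg H v + eB v.
  rewrite finset.in_setU negb_or => /andP[vI vB].
  have [/leq_trans -> //|lowv] := leqP k (deg H v); first by rewrite leq_addr.
  (* If no such [u] existed, [v |: I] would still satisfy [P], against maximality. *)
  have /exists_inP[u uI /andP[/eqP duv uvG]] :
      [exists u in I, (deg H u == deg H v) && adj G u v].
    apply: contraNT vI => /exists_inPn nuv.
    have {}nuv u : u \in I -> deg H u = deg H v -> ~~ adj G u v.
      by move=> /nuv; rewrite negb_and => + e; rewrite e eqxx.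
    suff /(maxsetsup maxI) <- : P (v |: I) by rewrite ?finset.subsetUr ?setU11.
    apply/andP; split; apply/forall_inP => x; rewrite !inE.
      by move=> /predU1P[->|/Ilow].
    move=> xI; apply/forall_inP => y; rewrite !inE => yI; apply/implyP => /eqP.
    case/predU1P: xI => [->|xI]; case/predU1P: yI => [->|yI].
    - by move=> _; apply/negP => /adj_neq; rewrite eqxx.
    - by move=> e; rewrite adj_sym nuv.
    - exact: nuv.
    - exact: Iind.
  have uvH : ~~ adj H u v.
    by apply: contra vB => uvH; apply/bigcupP; exists u; rewrite ?inE.
  have := saturated_nonedge _ _ satH uvG uvH; rewrite duv maxnn -/k => le.
  have {}le : k <= deg H v + #|nbhd H u :&: nbhd H v|.
    by rewrite /k; case: (w F) le.
  (* All common neighbours lie in [nbhd H u], which is contained in [B]. *)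
  apply: leq_trans le _; rewrite leq_add2l subset_leq_card // finset.setIC.
  by rewrite finset.setIS // /B (bigcup_max u).
(* Double counting of adjacencies into [B]: each [b] in [B] is counted at most [deg H b] times. *)
have sumB : \sum_(v | v \notin I :|: B) eB v <= \sum_(b in B) deg H b.
  apply: (@leq_trans (\sum_v eB v)).
    by rewrite [leqRHS](bigID (fun v => v \notin I :|: B)) leq_addr.
  have eBE v : eB v = \sum_(b in B | adj H v b) 1.
    by rewrite sum1dep_card; apply: eq_card => b; rewrite !inE andbC.
  under eq_bigr do rewrite eBE.
  rewrite (exchange_big_dep (fun b => b \in B)) /= => [|v b _ /andP[] //].
  apply: leq_sum => b bB; rewrite sum1dep_card /deg.
  by apply/subset_leq_card/fintype.subsetP => v; rewrite !inE adj_sym => /andP[].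
(* The complement of [I :|: B] is disjoint from [B], so both degree sums fit into the total degree
   sum. *)
have sumdeg : k * #|~: (I :|: B)| <= 2 * #|edges H|.
  apply: leq_trans (sum_deg_le _ H); rewrite mulnC -sum_nat_const.
  rewrite [leqRHS](bigID (fun v => v \notin I :|: B)) /=.
  apply: (@leq_trans (\sum_(v | v \notin I :|: B) (deg H v + eB v))).
    under eq_bigl do rewrite inE; exact: leq_sum.
  rewrite big_split leq_add2l; apply: leq_trans sumB _.
  rewrite [leqRHS](bigID (fun v => v \in B)) /= -[leqLHS]addn0.
  apply: leq_add => //; apply: eq_leq; apply: eq_bigl => v.
  by rewrite finset.in_setU negbK; case: (v \in B); rewrite ?orbT ?andbF.
rewrite -(cardsC (I :|: B)) mulnDr addnC leq_add //.
(* The sum of [k * a] and [k * a * k] is [k * w F * a] when [w F = k.+1]; if [w F = 0], then [k = 0]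
   and both sets are empty. *)
have leU : #|I :|: B| <= k * w F * a.
  apply: leq_trans (leq_card_setU _ _) _.
  have [w0|wpos] := posnP (w F); first by move: cardI cardB; rewrite /k w0 /=; lia.
  have -> : w F = k.+1 by rewrite /k prednK.
  by nia.
apply: leq_trans (leq_mul (leqnn k) leU) _.
have kw : k <= w F by rewrite leq_pred.
by rewrite !mulnA expnS expnS expn1 mulnA leq_mul // leq_mul // leq_mul.
Qed.

End Saturation.

(** * First moment bound for independent sets in G(n,p) *)

Section RandomGraph.
Local Open Scope ring_scope.
Variables (R : realType).

Lemma leq_ffact_exp (n k : nat) : (n ^_ k <= n ^ k)%N.
Proof.
rewrite ffact_prod -[k in (n ^ k)%N]card_ord -prod_nat_const.
by apply: leq_prod => i _; exact: leq_subr.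
Qed.
(** Expanding the right-hand product selects [a] or [b] at every pair; the pairs where [a] is
    selected form the edge set of a graph. *)
Lemma sum_sgraph (V : finType) (a b : {set V} -> R) :
  \sum_(G : sgraph V) \prod_(e : {set V} | #|e| == 2%N)
    (if e \in edges G then a e else b e) =
  \prod_(e : {set V} | #|e| == 2%N) (a e + b e).
Proof.
(* [bigA_distr] ranges over all families of sets; the weights 0 and 1 off the pairs cancel the
   families containing a non-pair and leave the others unchanged. *)
pose a' (e : {set V}) := if #|e| == 2%N then a e else 0.
pose b' (e : {set V}) := if #|e| == 2%N then b e else 1.
have -> : \prod_(e : {set V} | #|e| == 2%N) (a e + b e) = \prod_e (a' e + b' e).
  by rewrite big_mkcond; apply: eq_bigr => e _; rewrite /a' /b'; case: ifP => // _; rewrite add0r.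
rewrite bigA_distr (bigID (fun J : {set {set V}} => [forall e in J, #|e| == 2%N])) /=.
rewrite [X in _ + X]big1 ?addr0 => [|J /forall_inPn[e eJ e2]]; last first.
  by rewrite (bigD1 e) //= eJ /a' (negbTE e2) mul0r.
rewrite [RHS](reindex (@edges V)) /=; last first.
  exists (@sgraph_of V) => [G _|J /forall_inP J2].
    apply: val_inj; apply/setP => e /=; rewrite inE.
    by case: (boolP (e \in edges G)) => // /(forall_inP (edges_card2 G)) ->.
  by apply/setP => e /=; rewrite inE; case: (boolP (e \in J)) => // /J2 ->.
apply: eq_big => [G|G _]; first by rewrite edges_card2.
rewrite big_mkcond /=; apply: eq_bigr => e _; rewrite /a' /b'.
case: ifP => // e2; case: ifP => // eG.
by have := forall_inP (edges_card2 G) e eG; rewrite e2.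
Qed.

Variables (p : R) (n : nat).

(** Edge weight 0 on the pairs inside [S] restricts the sum to the event. Those pairs then
    contribute [1 - p], all others [p + (1 - p) = 1]. *)
Lemma gnp_prob_independent (S : {set 'I_n}) :
  gnp_prob p (fun G => independent G S) = (1 - p) ^+ 'C(#|S|, 2).
Proof.
pose a (e : {set 'I_n}) : R := if e \subset S then 0 else p.
transitivity (\prod_(e : {set 'I_n} | #|e| == 2%N) (a e + (1 - p))).
  rewrite -sum_sgraph /gnp_prob big_mkcond; apply: eq_bigr => G _ /=.
  rewrite independent_edges; case: forall_inP => [i|/forall_inP/forall_inPn[e eG]].
    by apply: eq_bigr => e _; case: ifP => // /i; rewrite /a => /negbTE->.
  rewrite negbK => eS; rewrite (bigD1 e) ?(forall_inP (edges_card2 G)) //=.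
  by rewrite eG /a eS mul0r.
rewrite -cards_draws -prodr_const (bigID (fun e : {set 'I_n} => e \subset S)) /=.
rewrite [X in _ * X]big1 ?mulr1 => [|e /andP[_ /negbTE eS]]; last first.
  by rewrite /a eS addrC subrK.
apply: eq_big => [e|e /andP[_ eS]]; first by rewrite inE andbC.
by rewrite /a eS add0r.
Qed.

Hypothesis (p01 : 0 <= p <= 1).

Lemma gnp_mass_ge0 (G : sgraph 'I_n) : 0 <= gnp_mass p G.
Proof. by apply: prodr_ge0 => e _; case/andP: p01 => p0 p1; case: ifP; rewrite ?subr_ge0. Qed.

Lemma gnp_prob_le (A B : pred (sgraph 'I_n)) :
  subpred A B -> gnp_prob p A <= gnp_prob p B.
Proof.
move=> AB; rewrite /gnp_prob [leRHS](bigID A) /=.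
rewrite [X in _ <= X + _](eq_bigl A) ?lerDl ?sumr_ge0 // => [G _|G].
  exact: gnp_mass_ge0.
by case: (boolP (A G)) => [/AB->|_]; rewrite ?andbF.
Qed.

Lemma gnp_prob_le1 (A : pred (sgraph 'I_n)) : gnp_prob p A <= 1.
Proof. by rewrite -(gnp_prob_total p n); apply: gnp_prob_le. Qed.

Lemma gnp_probC (A : pred (sgraph 'I_n)) :
  gnp_prob p A = 1 - gnp_prob p (predC A).
Proof.
rewrite -(gnp_prob_total p n) /gnp_prob [X in X - _](bigID A) /=.
by rewrite addrK.
Qed.

Lemma gnp_prob_exists (I : finType) (Q : {set I}) (A : I -> pred (sgraph 'I_n)) :
  gnp_prob p (fun G => [exists i in Q, A i G]) <= \sum_(i in Q) gnp_prob p (A i).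
Proof.
rewrite /gnp_prob; under [leRHS]eq_bigr do rewrite big_mkcond.
rewrite exchange_big /= big_mkcond; apply: ler_sum => G _.
have m0 := gnp_mass_ge0 G.
case: ifP => [/exists_inP[i iQ AiG]|_]; last by apply: sumr_ge0 => i _; case: ifP.
rewrite (bigD1 i) //= AiG lerDl sumr_ge0 // => j _; by case: ifP.
Qed.

(** Union bound over sets of size exactly [2 * m + 1], one of which lies in any larger independent
    set. The odd size gives [m * (2 * m + 1)] pairs, so the bound is a pure power. *)
Lemma gnp_prob_large_independent m :
  gnp_prob p (fun G => [exists S : {set 'I_n}, (2 * m < #|S|)%N && independent G S])
  <= (n%:R * (1 - p) ^+ m) ^+ (2 * m).+1.
Proof.
pose Q := [set S : {set 'I_n} | #|S| == (2 * m).+1].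
apply: (@le_trans _ _ (gnp_prob p (fun G => [exists S in Q, independent G S]))).
  apply: gnp_prob_le => G /existsP[S /andP[Sm iS]].
  have [T] : exists T : {set 'I_n}, T \in [set T : {set 'I_n} | T \subset S & #|T| == (2 * m).+1].
    by apply/set0Pn; rewrite -card_gt0 cards_draws bin_gt0.
  rewrite inE => /andP[TS Tm]; apply/exists_inP; exists T; first by rewrite inE.
  exact: independent_sub TS iS.
apply: le_trans (gnp_prob_exists _ Q (fun S G => independent G S)) _.
rewrite (eq_bigr (fun=> (1 - p) ^+ (m * (2 * m).+1))); last first.
  move=> S; rewrite inE gnp_prob_independent => /eqP->; congr (_ ^+ _).
  by rewrite bin2odd /= ?mul2n ?doubleK 1?mulnC //= odd_double.
rewrite sumr_const card_draws card_ord exprMn -exprM -[leLHS]mulr_natl -natrX.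
have p1 : p <= 1 by case/andP: p01.
rewrite ler_wpM2r ?exprn_ge0 ?subr_ge0 ?ler_nat //.
rewrite (@leq_trans (n ^_ (2 * m).+1)) ?leq_ffact_exp //.
by rewrite -bin_ffact leq_pmulr ?fact_gt0.
Qed.

End RandomGraph.

(** * Logarithmic independence number and the limit *)

Local Open Scope ring_scope.
Local Open Scope classical_set_scope.

Lemma gnp_independence_number (R : realType) (p : R) : 0 < p < 1 ->
  exists C : R, \forall n \near \oo, exists2 a : nat, a%:R <= C * ln n%:R &
    1 - n%:R^-1 <= gnp_prob p (fun G : sgraph 'I_n =>
      [forall S : {set 'I_n}, independent G S ==> (#|S| <= a)%N]).
Proof.
move=> /andP[p0 p1]; have q01 : 0 < 1 - p < 1 by lra.
have /andP[q0 q1] := q01.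
have p01 : 0 <= p <= 1 by rewrite !ltW.
have l0 := ln_lt0 q01; set l := ln (1 - p) in l0.
(* Solves [l * c = -2], so that the exponent [c * ln n] turns [1 - p] into [n^-2]. *)
pose c := - 2 / l; have c0 : 0 < c by rewrite /c ltr_ndivlMr // mul0r; lra.
exists (2 * (c + 1)); near=> n.
(* This gives [ln n >= 1], which absorbs the rounding: [m <= c * L + 1 <= (c + 1) * L]. *)
have ne : expR 1 <= n%:R :> R by near: n; exact: nbhs_infty_ger.
have n0 : 0 < n%:R :> R by apply: lt_le_trans ne; exact: expR_gt0.
have L1 : 1 <= ln n%:R :> R by rewrite -[leLHS](expRK 1) ler_ln // posrE expR_gt0.
set L := ln n%:R in L1 *; pose m := (Num.truncn (c * L)).+1.
have cL0 : 0 <= c * L by rewrite mulr_ge0 // ltW //; lra.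
have /andP[mle ltm] := truncn_itv cL0; rewrite -/m in ltm.
exists (2 * m)%N.
  rewrite natrM -mulrA ler_wpM2l // (le_trans (y := c * L + 1)) //.
    by rewrite /m -addn1 natrD lerD2r.
  by rewrite mulrDl mul1r lerD2l.
have qm : (1 - p) ^+ m <= n%:R^-1 ^+ 2.
  rewrite -[1 - p]lnK ?posrE // -/l -expRM_natr -[n%:R]lnK ?posrE // -/L -expRN.
  rewrite -expRM_natr ler_expR.
  have -> : - L * 2 = l * (c * L) by rewrite /c; field; rewrite lt_eqF.
  by rewrite ler_nM2l // ltW.
have nqm : n%:R * (1 - p) ^+ m <= n%:R^-1.
  rewrite (le_trans (ler_wpM2l (ltW n0) qm)) // expr2 mulrA mulfV ?mul1r //.
  by rewrite gt_eqF.
have n1 : n%:R^-1 <= 1 :> R.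
  rewrite invf_le1 // (le_trans _ ne) //.
  by rewrite (le_trans _ (expR_ge1Dx 1)) // lerDl.
rewrite gnp_probC lerD2l lerN2.
apply: (@le_trans _ _ ((n%:R * (1 - p) ^+ m) ^+ (2 * m).+1)).
  apply: le_trans (gnp_prob_large_independent _ _ _ p01 m); apply: gnp_prob_le => // G.
  move=> /forallPn[S]; rewrite negb_imply -ltnNge => /andP[iS Sm].
  by apply/existsP; exists S; rewrite Sm iS.
have nq0 : 0 <= n%:R * (1 - p) ^+ m by rewrite mulr_ge0 ?exprn_ge0 // ltW.
(* The base is at most [n^-1 <= 1], so one factor of the power suffices. *)
by rewrite exprS (le_trans _ nqm) // ler_piMr // exprn_ile1 // (le_trans nqm).
Unshelve. all: by end_near.
Qed.

Theorem theorem3p4 (R : realType) (p : R) (hp : 0 < p < 1)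
    (U : finType) (F : sgraph U) (hF : edges F != finset.set0) :
  exists C : R,
    (fun n : nat => gnp_prob p (fun G : sgraph 'I_n =>
       ((w F)%:R - 1) / 2 * n%:R - C * ln n%:R <= (sat G F)%:R))
      @ \oo --> (1 : R).
Proof.
have [C nearC] := gnp_independence_number _ _ hp.
have /andP[p0 p1] := hp; have p01 : 0 <= p <= 1 by rewrite !ltW.
exists ((w F ^ 3)%:R / 2 * C).
have cvgl : (fun n : nat => 1 - n%:R^-1 : R) @ \oo --> (1 : R).
  rewrite -[X in _ --> X]subr0; apply: cvgB; first exact: cvg_cst.
  (* The harmonic sequence is [1 / (n + 1)], hence the shift. *)
  by rewrite -cvg_shiftS; exact: cvg_harmonic.
apply: (squeeze_cvgr _ cvgl (cvg_cst _)); near=> n; rewrite gnp_prob_le1 // andbT.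
have [a aC /le_trans] : exists2 a : nat, a%:R <= C * ln n%:R &
    1 - n%:R^-1 <= gnp_prob p (fun G : sgraph 'I_n =>
      [forall S : {set 'I_n}, independent G S ==> (#|S| <= a)%N]) by near: n.
apply; apply: gnp_prob_le => // G /forallP indep.
have [H satH ->] := sat_attained G hF.
have := saturated_lower_bound _ _ _ _ _ a satH (fun S => implyP (indep S)).
rewrite card_ord -(ler_nat R) natrD !natrM => le.
(* Equality unless [w F = 0], where the truncated predecessor is the larger side. *)
have wle : (w F)%:R - 1 <= (w F).-1%:R :> R.
  by rewrite lerBlDr -[1 in leRHS]/(1%:R) -natrD ler_nat addn1 leqSpred.
have := ler_wpM2r (ler0n R n) wle.
have := ler_wpM2l (ler0n R (w F ^ 3)) aC.
move: le; set x := ln _; lra.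
Unshelve. all: by end_near.
Qed.
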